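(* Let $\mathbb{F}$ be a field and let $q\in\mathbb{F}$ be nonzero and not a root of unity. Let $\mathcal{H}(q)$ be the unital associative $\mathbb{F}$-algebra with generators $A,B$ and relation $AB-qBA=I$, regarded as a Lie algebra under the commutator $[f,g]=fg-gf$, and let $\mathfrak{L}(q)$ be the Lie subalgebra of $\mathcal{H}(q)$ generated by $A,B$. Then $\mathfrak{L}(q)$ is a Lie ideal of $\mathcal{H}(q)$, and the resulting quotient Lie algebra $\mathcal{H}(q)/\mathfrak{L}(q)$ is infinite-dimensional and one-step nilpotent.
   Context: $I$ denotes the multiplicative identity. ''$q$ is not a root of unity'' means $q^n\neq 1$ for all integers $n\ge 1$ (in particular $q\ne 1$). For a Lie algebra $\mathfrak{L}$ set $\mathfrak{L}^{(0)}=\mathfrak{L}$ and $\mathfrak{L}^{(p)}=[\mathfrak{L}^{(p-1)},\mathfrak{L}]$ (the span of all such brackets) for $p\ge 1$; $\mathfrak{L}$ is $p$-step nilpotent if $p$ is the smallest integer such that $\mathfrak{L}^{(p)}=0$. Thus a nonzero Lie algebra is one-step nilpotent if and only if all its brackets vanish. *)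

(* Defs.v *)
From HB Require Import structures.
From mathcomp Require Import all_boot all_algebra finmap.
From mathcomp Require Import boolp classical_sets.
From mathcomp Require Import monalg.

Set Implicit Arguments.
Unset Strict Implicit.
Unset Printing Implicit Defensive.

Import GRing.Theory.

Local Open Scope classical_set_scope.
Local Open Scope ring_scope.
Local Open Scope quotient_scope.

Section VectorSpaces.
Variables (F : fieldType) (V : lmodType F).

Definition is_subspace (U : set V) : Prop :=
  U 0 /\ forall (a : F) (x y : V), U x -> U y -> U (a *: x + y).

Definition span (S : set V) : set V := smallest is_subspace S.

Definition finite_dimensional : Prop :=
  exists s : seq V, span [set` s] = setT.

Definition infinite_dimensional : Prop := ~ finite_dimensional.

End VectorSpaces.

Arguments infinite_dimensional {F} V.
Arguments finite_dimensional {F} V.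

Section VectorQuotient.
Variables (F : fieldType) (V : lmodType F) (U : set V) (hU : is_subspace U).

(* [hU] only serves to key the closure instance below. *)
Definition subspace_pred of is_subspace U : {pred V} := fun x => `[< U x >].

Lemma subspace_predE x : (x \in subspace_pred hU) = `[< U x >].
Proof. by []. Qed.

Lemma subspace_pred_submod : submod_closed (subspace_pred hU).
Proof.
have [U0 UD] := hU; split; first exact/asboolP.
by move=> a x y /asboolP Ux /asboolP Uy; apply/asboolP; apply: UD.
Qed.

HB.instance Definition _ :=
  GRing.isSubmodClosed.Build F V (subspace_pred hU) subspace_pred_submod.

Definition vquot : Type := (Quotient.quot (subspace_pred hU)).

HB.instance Definition _ := GRing.Zmodule.on vquot.

Definition vproj (x : V) : vquot := \pi_((Quotient.quot (subspace_pred hU))) x.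

Lemma vprojP (x y : V) : vproj x = vproj y <-> U (x - y).
Proof.
split=> [/eqP|Uxy].
  by rewrite /vproj -Quotient.idealrBE => /asboolP.
by apply/eqP; rewrite /vproj -Quotient.idealrBE; apply/asboolP.
Qed.

Definition vrepr (x : vquot) : V := repr (x : (Quotient.quot (subspace_pred hU))).

Lemma vreprK x : vproj (vrepr x) = x.
Proof. exact: reprK. Qed.

Lemma vprojD x y : vproj (x + y) = vproj x + vproj y.
Proof. exact: Quotient.pi_add. Qed.

Lemma vprojN x : vproj (- x) = - vproj x.
Proof. exact: Quotient.pi_opp. Qed.

Lemma vproj0 : vproj 0 = 0.
Proof. by rewrite -(subrr 0) vprojD vprojN subrr. Qed.

Lemma vrepr_proj x : U (vrepr (vproj x) - x).
Proof. by apply/vprojP; rewrite vreprK. Qed.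

Definition vquot_scale (a : F) (x : vquot) : vquot := vproj (a *: vrepr x).

Lemma vprojZ a x : vproj (a *: x) = vquot_scale a (vproj x).
Proof.
apply/esym/vprojP; rewrite -scalerBr -[_ *: _]addr0.
by case: (hU) => U0 UD; apply: UD => //; apply: vrepr_proj.
Qed.

Lemma vquot_scaleA a b x :
  vquot_scale a (vquot_scale b x) = vquot_scale (a * b) x.
Proof. by rewrite -[x]vreprK -!vprojZ scalerA. Qed.

Lemma vquot_scale1 : left_id 1 vquot_scale.
Proof. by move=> x; rewrite -[x]vreprK -!vprojZ scale1r. Qed.

Lemma vquot_scaleDr : right_distributive vquot_scale +%R.
Proof.
move=> a x y; rewrite -[x]vreprK -[y]vreprK -vprojD -!vprojZ -vprojD.
by rewrite scalerDr.
Qed.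

Lemma vquot_scaleDl x : {morph vquot_scale^~ x : a b / a + b}.
Proof.
by move=> a b; rewrite -[x]vreprK -!vprojZ -vprojD scalerDl.
Qed.

HB.instance Definition _ := GRing.Zmodule_isLmodule.Build F vquot
  vquot_scaleA vquot_scale1 vquot_scaleDr vquot_scaleDl.

Lemma vproj_is_linear : linear vproj.
Proof. by move=> a x y; rewrite vprojD vprojZ. Qed.

HB.instance Definition _ := GRing.isLinear.Build F V vquot _ vproj
  vproj_is_linear.

End VectorQuotient.

Section AlgebraQuotient.
Variables (F : fieldType) (A : algType F).

Definition is_ideal (J : set A) : Prop :=
  is_subspace J /\
  forall a x : A, J x -> J (a * x) /\ J (x * a).

Definition ideal_generated (S : set A) : set A := smallest is_ideal S.

Lemma ideal_generated_is_ideal (S : set A) : is_ideal (ideal_generated S).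
Proof.
split; first split=> [J [[[]]]//|a x y Jx Jy J JS].
  have [[[_ JD] _] _] := JS; apply: JD; [exact: Jx | exact: Jy].
move=> a x Jx; split=> J JS; have [[_ JM] _] := JS.
  by have [] := JM a x (Jx J JS).
by have [] := JM a x (Jx J JS).
Qed.

Variables (J : set A) (hJ : is_ideal J) (J1 : ~ J 1).

(* Nontrivial rings are part of [algType], hence the argument [J1]. *)
Definition alg_quot of ~ J 1 : Type := vquot hJ.1.

HB.instance Definition _ := GRing.Lmodule.on (alg_quot J1).

Definition alg_proj : A -> alg_quot J1 := @vproj F A J hJ.1.

HB.instance Definition _ := GRing.Linear.copy alg_proj (@vproj F A J hJ.1).

Definition alg_repr : alg_quot J1 -> A := @vrepr F A J hJ.1.

Lemma alg_projP x y : alg_proj x = alg_proj y <-> J (x - y).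
Proof. exact: vprojP. Qed.

Lemma alg_reprK : cancel alg_repr alg_proj.
Proof. exact: vreprK. Qed.

Definition alg_quot_one : alg_quot J1 := alg_proj 1.

Definition alg_quot_mul (x y : alg_quot J1) : alg_quot J1 :=
  alg_proj (alg_repr x * alg_repr y).

Lemma alg_projM x y :
  alg_proj (x * y) = alg_quot_mul (alg_proj x) (alg_proj y).
Proof.
apply/esym/alg_projP.
set x' := alg_repr _; set y' := alg_repr _.
have -> : x' * y' - x * y = 1 *: ((x' - x) * y') + x * (y' - y).
  by rewrite scale1r mulrBl mulrBr addrA subrK.
have [[_ JD] JM] := hJ; apply: JD.
  by apply: (JM _ _ _).2; apply: vrepr_proj.
by apply: (JM _ _ _).1; apply: vrepr_proj.
Qed.

Lemma alg_quot_mulA : associative alg_quot_mul.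
Proof.
move=> x y z; rewrite -[x]alg_reprK -[y]alg_reprK -[z]alg_reprK.
by rewrite -!alg_projM mulrA.
Qed.

Lemma alg_quot_mul1q : left_id alg_quot_one alg_quot_mul.
Proof. by move=> x; rewrite -[x]alg_reprK -alg_projM mul1r. Qed.

Lemma alg_quot_mulq1 : right_id alg_quot_one alg_quot_mul.
Proof. by move=> x; rewrite -[x]alg_reprK -alg_projM mulr1. Qed.

Lemma alg_quot_mulDl : left_distributive alg_quot_mul +%R.
Proof.
move=> x y z; rewrite -[x]alg_reprK -[y]alg_reprK -[z]alg_reprK.
by rewrite -linearD -!alg_projM mulrDl linearD.
Qed.

Lemma alg_quot_mulDr : right_distributive alg_quot_mul +%R.
Proof.
move=> x y z; rewrite -[x]alg_reprK -[y]alg_reprK -[z]alg_reprK.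
by rewrite -linearD -!alg_projM mulrDr linearD.
Qed.

Lemma alg_quot_one_neq0 : alg_quot_one != 0.
Proof.
by apply/eqP; rewrite -(linear0 alg_proj) => /alg_projP; rewrite subr0.
Qed.

HB.instance Definition _ := GRing.Zmodule_isNzRing.Build (alg_quot J1)
  alg_quot_mulA alg_quot_mul1q alg_quot_mulq1 alg_quot_mulDl alg_quot_mulDr
  alg_quot_one_neq0.

Lemma alg_proj_is_monoid_morphism : monoid_morphism alg_proj.
Proof. by split=> // x y; exact: alg_projM. Qed.

HB.instance Definition _ := GRing.isMonoidMorphism.Build A (alg_quot J1)
  alg_proj alg_proj_is_monoid_morphism.

Lemma alg_quot_scaleAl (a : F) (x y : alg_quot J1) :
  a *: (x * y) = (a *: x) * y.
Proof.
rewrite -[x]alg_reprK -[y]alg_reprK.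
by rewrite -rmorphM -!linearZ -rmorphM /= scalerAl.
Qed.

HB.instance Definition _ := GRing.Lmodule_isLalgebra.Build F (alg_quot J1)
  alg_quot_scaleAl.

Lemma alg_quot_scaleAr (a : F) (x y : alg_quot J1) :
  a *: (x * y) = x * (a *: y).
Proof.
rewrite -[x]alg_reprK -[y]alg_reprK.
by rewrite -rmorphM -!linearZ -rmorphM /= scalerAr.
Qed.

HB.instance Definition _ := GRing.Lalgebra_isAlgebra.Build F (alg_quot J1)
  alg_quot_scaleAr.

End AlgebraQuotient.

Lemma malg_scaleAr (F : fieldType) (K : monomType) (a : F)
  (x y : {malg F[K]}) : a *: (x * y) = x * (a *: y).
Proof.
apply/malgP => k; rewrite mcoeffZ mcoeffMl mulr_sumr.
rewrite (@mcoeffMlw _ _ (msupp x) (msupp y)) ?msuppZ_le //.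
apply: eq_bigr => k1 _; rewrite mulr_sumr; apply: eq_bigr => k2 _.
by rewrite mcoeffZ mulrnAr mulrCA.
Qed.

Section FreeAlgebra.
Variables (F : fieldType) (X : choiceType).

(* Noncommutative polynomials: the monoid algebra of words over [X]. *)
Definition free_alg : Type := {malg F[{fmonom X}]}.

HB.instance Definition _ := GRing.Lalgebra.on free_alg.

Lemma free_alg_scaleAr (a : F) (x y : free_alg) : a *: (x * y) = x * (a *: y).
Proof. exact: (@malg_scaleAr F {fmonom X}). Qed.

HB.instance Definition _ := GRing.Lalgebra_isAlgebra.Build F free_alg
  free_alg_scaleAr.

Definition free_gen (i : X) : free_alg := << fmu i >>.

End FreeAlgebra.

Arguments free_gen F {X} i.

HB.mixin Record Lmodule_isLieAlgebra (F : fieldType) L of GRing.Lmodule F L := {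
  lie : L -> L -> L;
  lie_linearl : forall (a : F) (x y z : L),
    lie (a *: x + y) z = a *: lie x z + lie y z;
  lie_linearr : forall (a : F) (x y z : L),
    lie z (a *: x + y) = a *: lie z x + lie z y;
  liexx : forall x : L, lie x x = 0;
  lie_jacobi : forall x y z : L,
    lie x (lie y z) + lie y (lie z x) + lie z (lie x y) = 0
}.

#[short(type="lieAlgType")]
HB.structure Definition LieAlgebra (F : fieldType) :=
  {L of GRing.Lmodule F L & Lmodule_isLieAlgebra F L}.

Section CommutatorLieAlgebra.
Variables (F : fieldType) (A : algType F).

(* The associative algebra [A] regarded as a Lie algebra. *)
Definition comm_lie : Type := A.

HB.instance Definition _ := GRing.Lmodule.on comm_lie.

Definition commutator (x y : A) : A := x * y - y * x.

Lemma commutator_linearl (a : F) (x y z : A) :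
  commutator (a *: x + y) z = a *: commutator x z + commutator y z.
Proof.
rewrite /commutator mulrDl mulrDr -scalerAl -scalerAr scalerBr opprD.
by rewrite addrACA.
Qed.

Lemma commutator_linearr (a : F) (x y z : A) :
  commutator z (a *: x + y) = a *: commutator z x + commutator z y.
Proof.
rewrite /commutator mulrDl mulrDr -scalerAl -scalerAr scalerBr opprD.
by rewrite addrACA.
Qed.

Lemma commutatorxx (x : A) : commutator x x = 0.
Proof. exact: subrr. Qed.

Lemma commutator_jacobi (x y z : A) :
  commutator x (commutator y z) + commutator y (commutator z x)
    + commutator z (commutator x y) = 0.
Proof.
have comm2 u v w : commutator u (commutator v w)
    = (u * v * w + w * v * u) - (u * w * v + v * w * u).
  rewrite /commutator mulrBl mulrBr !mulrA opprB opprD.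
  by rewrite addrACA.
rewrite !comm2 [y * z * x + x * z * y]addrC [z * x * y + y * x * z]addrC.
rewrite [z * y * x + x * y * z]addrC.
have telescope (u v w : A) : u - v + (v - w) + (w - u) = 0.
  by rewrite !addrA !subrK subrr.
exact: telescope.
Qed.

HB.instance Definition _ := Lmodule_isLieAlgebra.Build F comm_lie
  commutator_linearl commutator_linearr commutatorxx commutator_jacobi.

End CommutatorLieAlgebra.

Section LieSubstructures.
Variables (F : fieldType) (L : lieAlgType F).

Definition is_lie_subalgebra (U : set L) : Prop :=
  is_subspace U /\ forall x y : L, U x -> U y -> U (lie x y).

Definition lie_generated (S : set L) : set L := smallest is_lie_subalgebra S.

Definition is_lie_ideal (U : set L) : Prop :=
  is_subspace U /\ forall x u : L, U u -> U (lie x u).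

(* Indexed from 0: [L^(0) = L] and [L^(p+1) = [L^(p), L]]. *)
Fixpoint lower_central (p : nat) : set L :=
  if p is p'.+1 then
    span [set z | exists x y : L, lower_central p' x /\ z = lie x y]
  else setT.

Definition step_nilpotent (p : nat) : Prop :=
  lower_central p = [set 0] /\
  forall m : nat, (m < p)%N -> lower_central m <> [set 0].

Lemma lie0r (x : L) : lie x 0 = 0.
Proof.
have := lie_linearr 1 (0 : L) 0 x; rewrite !scale1r addr0 => /esym/eqP.
by rewrite -subr_eq0 addrK => /eqP.
Qed.

Lemma lieDl (x y z : L) : lie (x + y) z = lie x z + lie y z.
Proof. by rewrite -[x]scale1r lie_linearl !scale1r. Qed.

Lemma lieDr (x y z : L) : lie z (x + y) = lie z x + lie z y.
Proof. by rewrite -[x]scale1r lie_linearr !scale1r. Qed.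

Lemma lie_anticomm (x y : L) : lie x y = - lie y x.
Proof.
apply/eqP; rewrite -addr_eq0; apply/eqP.
by have := liexx (x + y); rewrite lieDl !lieDr !liexx add0r addr0.
Qed.

End LieSubstructures.

Arguments step_nilpotent {F} L p.
Arguments lower_central {F} L p.

Section LieQuotient.
Variables (F : fieldType) (L : lieAlgType F) (U : set L).
Variable hU : is_lie_ideal U.

Definition lie_quot : Type := vquot hU.1.

HB.instance Definition _ := GRing.Lmodule.on lie_quot.

Definition lie_proj : L -> lie_quot := @vproj F L U hU.1.

HB.instance Definition _ := GRing.Linear.copy lie_proj (@vproj F L U hU.1).

Definition lie_repr : lie_quot -> L := @vrepr F L U hU.1.

Lemma lie_projP x y : lie_proj x = lie_proj y <-> U (x - y).
Proof. exact: vprojP. Qed.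

Lemma lie_reprK : cancel lie_repr lie_proj.
Proof. exact: vreprK. Qed.

Definition lie_quot_bracket (x y : lie_quot) : lie_quot :=
  lie_proj (lie (lie_repr x) (lie_repr y)).

Lemma lie_proj_bracket x y :
  lie_proj (lie x y) = lie_quot_bracket (lie_proj x) (lie_proj y).
Proof.
apply/esym/lie_projP.
have [[U0 UD] UL] := hU.
set x' := lie_repr _; set y' := lie_repr _.
have Ux : U (x' - x) by apply: vrepr_proj.
have Uy : U (y' - y) by apply: vrepr_proj.
have UN z : U z -> U (- z).
  by move=> Uz; rewrite -scaleN1r -[_ *: _]addr0; apply: UD.
have -> : lie x' y' - lie x y = 1 *: lie (x' - x) y' + lie x (y' - y).
  have -> : lie x' y' = lie (x' - x) y' + lie x y' by rewrite -lieDl subrK.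
  have -> : lie x y' = lie x (y' - y) + lie x y by rewrite -lieDr subrK.
  by rewrite scale1r addrA addrK.
apply: UD; last exact: UL.
by rewrite lie_anticomm; apply/UN/UL.
Qed.

Lemma lie_quot_linearl (a : F) (x y z : lie_quot) :
  lie_quot_bracket (a *: x + y) z
  = a *: lie_quot_bracket x z + lie_quot_bracket y z.
Proof.
rewrite -[x]lie_reprK -[y]lie_reprK -[z]lie_reprK.
by rewrite -linearP -!lie_proj_bracket lie_linearl linearP.
Qed.

Lemma lie_quot_linearr (a : F) (x y z : lie_quot) :
  lie_quot_bracket z (a *: x + y)
  = a *: lie_quot_bracket z x + lie_quot_bracket z y.
Proof.
rewrite -[x]lie_reprK -[y]lie_reprK -[z]lie_reprK.
by rewrite -linearP -!lie_proj_bracket lie_linearr linearP.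
Qed.

Lemma lie_quotxx (x : lie_quot) : lie_quot_bracket x x = 0.
Proof. by rewrite -[x]lie_reprK -lie_proj_bracket liexx linear0. Qed.

Lemma lie_quot_jacobi (x y z : lie_quot) :
  lie_quot_bracket x (lie_quot_bracket y z)
    + lie_quot_bracket y (lie_quot_bracket z x)
    + lie_quot_bracket z (lie_quot_bracket x y) = 0.
Proof.
rewrite -[x]lie_reprK -[y]lie_reprK -[z]lie_reprK.
by rewrite -!lie_proj_bracket -!linearD lie_jacobi linear0.
Qed.

HB.instance Definition _ := Lmodule_isLieAlgebra.Build F lie_quot
  lie_quot_linearl lie_quot_linearr lie_quotxx lie_quot_jacobi.

End LieQuotient.

Section QHeisenberg.
Variables (F : fieldType) (q : F).

Local Notation FA := (free_alg F 'I_2).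

Definition qheis_relator : FA :=
  free_gen F 0 * free_gen F 1 - q *: (free_gen F 1 * free_gen F 0) - 1.

Definition qheis_ideal : set FA := ideal_generated [set qheis_relator].

(* The ideal is proper because the free algebra acts on sequences, with    *)
(* generator 0 ([A]) as the q-derivative and generator 1 ([B]) as the      *)
(* shift, and the relator [A B - q B A - 1] acts as 0.                     *)
Let dq (f : nat -> F) (n : nat) : F := (\sum_(i < n.+1) q ^+ i) * f n.+1.
Let sh (f : nat -> F) (n : nat) : F := if n is n'.+1 then f n' else 0.
Let gen_act (i : 'I_2) := if i == 0 then dq else sh.
Let word_act (s : seq 'I_2) (f : nat -> F) : nat -> F := foldr gen_act f s.
Let act (g : FA) (f : nat -> F) (n : nat) : F :=
  mmap idfun (fun k : {fmonom 'I_2} => word_act k f n) g.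

Let word_act_sum (I : Type) (r : seq I) (c : I -> F) (h : I -> nat -> F) s n :
  word_act s (fun m => \sum_(j <- r) c j * h j m) n
  = \sum_(j <- r) c j * word_act s (h j) n.
Proof.
elim: s n => [//|i s IHs] n /=; rewrite /gen_act; case: ifP => _.
  rewrite /dq IHs mulr_sumr; apply: eq_bigr => j _; exact: mulrCA.
case: n => [|n] /=; last exact: IHs.
by rewrite big1 // => j _; rewrite mulr0.
Qed.

Let word_act_ext s f g : f =1 g -> word_act s f =1 word_act s g.
Proof.
move=> fg; elim: s => [//|i s IHs] n /=; rewrite /gen_act; case: ifP => _.
  by rewrite /dq IHs.
by case: n => [|n] /=.
Qed.

Let word_act0 s n : word_act s (fun=> 0) n = 0.
Proof.
elim: s n => [//|i s IHs] n /=; rewrite /gen_act; case: ifP => _.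
  by rewrite /dq IHs mulr0.
by case: n => [|n] /=.
Qed.

Let actD g h f n : act (g + h) f n = act g f n + act h f n.
Proof. exact: mmapD. Qed.

Let actM g h f n : act (g * h) f n = act g (act h f) n.
Proof.
rewrite [g * h](@malgME {fmonom 'I_2} F) /act raddf_sum /= mmapE.
apply: eq_bigr => k1 _; rewrite raddf_sum /=.
rewrite (word_act_ext _ (fun m => mmapE _ _ _)) word_act_sum mulr_sumr.
apply: eq_bigr => k2 _; rewrite mmapU /= fmM /word_act foldr_cat.
by rewrite mulrA.
Qed.

Let act1 f n : act 1 f n = f n.
Proof. by rewrite /act [1]/(@fgone {fmonom 'I_2} F) mmapU /= fm1 mul1r. Qed.

Let act_gen i f n : act (free_gen F i) f n = gen_act i f n.
Proof. by rewrite /act mmapU /= fmU /= mul1r. Qed.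

Let actZ a g f n : act (a *: g) f n = a * act g f n.
Proof.
rewrite /act (mmapEw (msuppZ_le _ _)) mmapE mulr_sumr.
by apply: eq_bigr => k _; rewrite mcoeffZ mulrA.
Qed.

Let act_lincomb g h k f n :
  act (g - q *: h - k) f n = act g f n - q * act h f n - act k f n.
Proof.
have actN u m : act (- u) f m = - act u f m by rewrite -scaleN1r actZ mulN1r.
by rewrite (actD _ (- k)) (actD g) !actN actZ.
Qed.

Let act_relator f n : act qheis_relator f n = 0.
Proof.
pose A : FA := free_gen F 0; pose B : FA := free_gen F 1.
have AB : act (A * B) f n = dq (sh f) n.
  rewrite (actM A B) (act_gen 0) /gen_act /= /dq; congr (_ * _).
  by rewrite (act_gen 1).
have BA : act (B * A) f n = sh (dq f) n.
  rewrite (actM B A) (act_gen 1) /gen_act /=; case: (n) => //= m.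
  by rewrite (act_gen 0).
have -> : act qheis_relator f n = dq (sh f) n - q * sh (dq f) n - f n.
  by rewrite -AB -BA -(act1 f n); exact: (act_lincomb (A * B) (B * A) 1).
clear AB BA; rewrite /dq; case: n => [|n] /=.
  by rewrite big_ord1 expr0 mul1r mulr0 subr0 subrr.
rewrite [in X in X * f _ + _]big_ord_recl /= expr0.
have -> : \sum_(i < n.+1) q ^+ bump 0 i = q * \sum_(i < n.+1) q ^+ i.
  by rewrite mulr_sumr; apply: eq_bigr => i _; rewrite -exprS.
by rewrite mulrDl mul1r mulrA addrK subrr.
Qed.

Lemma qheis_ideal_proper : ~ qheis_ideal 1.
Proof.
pose K : set FA := [set g | forall f n, act g f n = 0].
suff idK : is_ideal K /\ [set qheis_relator] `<=` K.
  by move=> /(_ K idK (fun=> 1) 0%N)/eqP; rewrite act1 oner_eq0.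
split; last by move=> _ -> f n; exact: act_relator.
split; [split=> [f n|a g h Kg Kh f n] | move=> a g Kg; split=> f n].
- exact: mmap0.
- by rewrite (actD (a *: g) h) (actZ a g) Kg Kh mulr0 addr0.
- rewrite (actM a g) (_ : act g f = fun=> 0); last exact/funext/Kg.
  by rewrite /act mmapE big1 // => k _; rewrite word_act0 mulr0.
- by rewrite (actM g a) Kg.
Qed.

Definition qheis : algType F :=
  alg_quot (ideal_generated_is_ideal [set qheis_relator]) qheis_ideal_proper.

Definition qheis_proj : FA -> qheis := @alg_proj _ _ _ _ qheis_ideal_proper.

Definition qheisA : qheis := qheis_proj (free_gen F 0).
Definition qheisB : qheis := qheis_proj (free_gen F 1).

Lemma qheis_relation : qheisA * qheisB - q *: (qheisB * qheisA) = 1.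
Proof.
rewrite /qheisA /qheisB /qheis_proj -!rmorphM -linearZ -linearB.
by apply/alg_projP => J [_]; apply.
Qed.

Definition qheis_lie : lieAlgType F := comm_lie qheis.

Definition qheis_lie_gen : set qheis_lie :=
  lie_generated [set (qheisA : qheis_lie); (qheisB : qheis_lie)].

End QHeisenberg.

Arguments qheis_lie {F} q.
Arguments qheis_lie_gen {F} q.

(* Main.v *)
(* Write H = H(q), L = L(q) and C = [A, B]. Since AC = qCA and CB = qBC, the
   element C generates the two-sided ideal CH, modulo which A and B commute;
   hence [H, H] is contained in CH. Bracketing with A and B produces from C all
   C^k A^l and C^k B^l with k > 0, because no q^k - 1 with k > 0 vanishes, and
   these elements span CH. Hence L contains CH, so it is an ideal with abelian
   quotient. The quotient is infinite-dimensional because at the characters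
   A |-> t, B |-> t^-1 / (1 - q) the elements of L take the values c t + d / t,
   so that A^2, A^3, ... are linearly independent modulo L: the points t = q^n
   are infinitely many. *)
From HB Require Import structures.
Require Import Defs.
From mathcomp Require Import all_boot all_algebra finmap.
From mathcomp Require Import boolp classical_sets monalg.

Set Implicit Arguments.
Unset Strict Implicit.
Unset Printing Implicit Defensive.

Import GRing.Theory.

Local Open Scope ring_scope.

(** * Linear algebra: subspaces, spans, linear dependence *)

Section Subspaces.
Variables (F : fieldType) (V : lmodType F) (U : set V) (hU : is_subspace U).

Lemma subspaceZ a x : U x -> U (a *: x).
Proof. by case: hU => U0 UD Ux; rewrite -[_ *: _]addr0; apply: UD. Qed.

Lemma subspaceD x y : U x -> U y -> U (x + y).
Proof. by case: hU => _ UD Ux Uy; rewrite -[x]scale1r; apply: UD. Qed.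

Lemma subspaceB x y : U x -> U y -> U (x - y).
Proof. by move=> Ux Uy; rewrite -scaleN1r; apply/subspaceD/subspaceZ. Qed.

Lemma subspaceZK a x : a != 0 -> U (a *: x) -> U x.
Proof. by move=> a0 /(subspaceZ a^-1); rewrite scalerA mulVf ?scale1r. Qed.

Lemma subspace_sum (I : Type) (r : seq I) (v : I -> V) :
  (forall i, U (v i)) -> U (\sum_(i <- r) v i).
Proof.
by case: hU => U0 _ Uv; apply: big_ind => // x y; exact: subspaceD.
Qed.

End Subspaces.

Lemma span_seqP (F : fieldType) (V : lmodType F) (s : seq V) (x : V) :
  Defs.span [set` s]%classic x ->
  exists c : 'I_(size s) -> F, x = \sum_i c i *: s`_i.
Proof.
move=> sx; apply: (sx [set y | exists c : 'I_(size s) -> F,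
  y = \sum_i c i *: s`_i]%classic); split=> [|y /= /(nthP 0)].
  split; first by exists (fun=> 0); rewrite big1 // => i _; rewrite scale0r.
  move=> a _ _ [c ->] [d ->]; exists (fun i => a * c i + d i).
  rewrite scaler_sumr -big_split /=; apply: eq_bigr => i _.
  by rewrite scalerA -scalerDl.
case=> i lti <-; exists (fun j => (j == Ordinal lti)%:R) => /=.
rewrite (bigD1 (Ordinal lti)) //= eqxx scale1r big1 ?addr0 // => j /negPf ->.
by rewrite scale0r.
Qed.

(** If [d] vectors span, the coordinates of [d + 1] of the [v i] form a matrix with more rows than
    columns. A nonzero vector of its left kernel is the required relation. *)
Lemma finite_dimensional_dependent (F : fieldType) (V : lmodType F)
    (v : nat -> V) : finite_dimensional V ->
  exists n (c : 'rV[F]_n), c != 0 /\ \sum_i c 0 i *: v i = 0.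
Proof.
case=> s sT; set d := size s.
have coordP i : {c : 'I_d -> F | v i = \sum_j c j *: s`_j}.
  by apply/cid/span_seqP; rewrite sT.
pose M := \matrix_(i < d.+1, j < d) sval (coordP i) j.
have : kermx M != 0.
  rewrite kermx_eq0 /row_free neq_ltn (leq_ltn_trans (rank_leq_col M)) //.
case/rowV0Pn => c /sub_kermxP cM c0; exists d.+1, c; split=> //.
under eq_bigr => i _ do rewrite (svalP (coordP i)) scaler_sumr.
rewrite exchange_big big1 //= => j _.
under eq_bigr => i _ do rewrite scalerA.
rewrite -scaler_suml; move/rowP/(_ j): cM; rewrite !mxE => cMj.
rewrite (_ : \sum_i _ = 0) ?scale0r // -[RHS]cMj.
by apply: eq_bigr => i _; rewrite mxE.
Qed.

(** * Commutation rules in an algebra with A B - q B A = 1 *)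

Section QRelation.
Variables (F : fieldType) (q : F) (R : algType F) (A B : R).
Hypothesis AB_rel : A * B - q *: (B * A) = 1.

Local Notation C := (commutator A B).

Let ABE : A * B = q *: (B * A) + 1.
Proof. by apply/eqP; rewrite addrC -subr_eq AB_rel. Qed.

(** Up to the factor [q - 1], both [B * A] and [A * B] are affine in [C]; this is how mixed products
    are eliminated later. *)
Lemma scale_BA : (q - 1) *: (B * A) = C - 1.
Proof. by rewrite /commutator ABE addrAC addrK scalerBl scale1r. Qed.

Lemma scale_AB : (q - 1) *: (A * B) = q *: C - 1.
Proof.
have {1}-> : A * B = C + B * A by rewrite subrK.
rewrite scalerDr scale_BA scalerBl.
by rewrite scale1r addrA subrK.
Qed.

Let CE : C = (q - 1) *: (B * A) + 1.
Proof. by rewrite scale_BA subrK. Qed.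

Lemma mul_A_comm : A * C = q *: (C * A).
Proof.
rewrite {1 2}CE mulrDr mulrDl mulr1 mul1r -scalerAr -scalerAl mulrA ABE.
rewrite mulrDl -scalerAl mul1r !scalerDr -addrA; congr (_ + _).
  by rewrite !scalerA mulrC.
by rewrite scalerBl scale1r subrK.
Qed.

Lemma mul_comm_B : C * B = q *: (B * C).
Proof.
rewrite {1 2}CE mulrDr mulrDl mulr1 mul1r -scalerAr -scalerAl -mulrA ABE.
rewrite mulrDr -scalerAr mulr1 !scalerDr -addrA; congr (_ + _).
  by rewrite !scalerA mulrC.
by rewrite scalerBl scale1r subrK.
Qed.

Lemma mul_A_commX k : A * C ^+ k = q ^+ k *: (C ^+ k * A).
Proof.
elim: k => [|k IHk]; first by rewrite !expr0 mulr1 mul1r scale1r.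
rewrite !exprSr mulrA IHk -scalerAl -(mulrA _ A) mul_A_comm -scalerAr.
by rewrite scalerA !mulrA.
Qed.

Lemma mul_commX_B k : C ^+ k * B = q ^+ k *: (B * C ^+ k).
Proof.
elim: k => [|k IHk]; first by rewrite !expr0 mulr1 mul1r scale1r.
rewrite !exprS -mulrA IHk -scalerAr (mulrA C) mul_comm_B -scalerAl scalerA.
by rewrite (mulrC q) !mulrA.
Qed.

Lemma mul_AX_comm l : A ^+ l * C = q ^+ l *: (C * A ^+ l).
Proof.
elim: l => [|l IHl]; first by rewrite !expr0 mulr1 mul1r scale1r.
rewrite !exprS -mulrA IHl -scalerAr (mulrA A) mul_A_comm -scalerAl scalerA.
by rewrite (mulrC q) !mulrA.
Qed.

Lemma mul_comm_BX l : C * B ^+ l = q ^+ l *: (B ^+ l * C).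
Proof.
elim: l => [|l IHl]; first by rewrite !expr0 mulr1 mul1r scale1r.
rewrite !exprSr mulrA IHl -scalerAl -(mulrA _ C) mul_comm_B -scalerAr.
by rewrite scalerA !mulrA.
Qed.

(** * The two-sided ideal generated by C *)

Hypothesis q0 : q != 0.
(** Expresses that [A] and [B] generate [R] as a unital algebra, in the form of an induction that
    appends letters on the right. *)
Hypothesis R_ind : forall P : R -> Prop, is_subspace P -> P 1 ->
  (forall x, P x -> P (x * A)) -> (forall x, P x -> P (x * B)) ->
  forall x, P x.

Let qX0 l : q ^+ l != 0.
Proof. by rewrite expf_neq0. Qed.

(** [A] and [B] commute with [C] up to powers of [q], so [C] can be pulled to the front of any
    word. *)
Lemma mul_comm_ideal x y : exists z, x * (C * y) = C * z.
Proof.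
suff [z xC] : exists z, x * C = C * z by exists (z * y); rewrite mulrA xC mulrA.
elim/R_ind: x => [||x [z xC]|x [z xC]].
- split=> [|a u v [z uC] [t vC]]; first by exists 0; rewrite mul0r mulr0.
  by exists (a *: z + t); rewrite mulrDl (mulrDr C) -scalerAl -scalerAr uC vC.
- by exists 1; rewrite mulr1 mul1r.
- exists (q *: (z * A)).
  by rewrite -mulrA mul_A_comm -!scalerAr !mulrA xC.
(* Here x B C = q^-1 x C B = q^-1 C z B. *)
- exists (q^-1 *: (z * B)); rewrite -scalerAr mulrA -xC -!mulrA mul_comm_B.
  by rewrite -scalerAr scalerA mulVf // scale1r.
Qed.

Let comm_ideal : set R := [set y | exists z, y = C * z]%classic.

Let ideal_subspace : is_subspace comm_ideal.
Proof.
split=> [|a _ _ [z ->] [t ->]]; first by exists 0; rewrite mulr0.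
by exists (a *: z + t); rewrite (mulrDr C) -scalerAr.
Qed.

(** By the Leibniz rule [u v, w] = u [v, w] + [u, w] v and the ideal property, the first argument
    reduces to [A] and [B]. Antisymmetry then gives the same reduction for the second, leaving only
    [C], its opposite and 0. *)
Lemma commutator_in_ideal x y : exists z, commutator x y = C * z.
Proof.
have JC x' y' : comm_ideal (commutator x' y') -> comm_ideal (commutator y' x').
  move=> /(subspaceZ ideal_subspace (-1)).
  by rewrite /commutator scaleN1r opprB.
have J_ind w x' : comm_ideal (commutator A w) -> comm_ideal (commutator B w) ->
    comm_ideal (commutator x' w).
  move=> Aw Bw; have step u v : comm_ideal (commutator u w) ->
      comm_ideal (commutator v w) -> comm_ideal (commutator (u * v) w).
    move=> [z uw] [t vw]; have [r ur] := mul_comm_ideal u t.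
    exists (r + z * v); rewrite (mulrDr C) -ur -vw (mulrA C) -uw /commutator.
    by rewrite mulrBr mulrBl !mulrA addrA subrK.
  elim/R_ind: x' => [|||].
  - split=> [|a u v Ju Jv]; last rewrite commutator_linearl.
      by exists 0; rewrite /commutator mulr0 !mul0r mulr0 subrr.
    exact: ideal_subspace.2.
  - by exists 0; rewrite /commutator mulr1 mul1r mulr0 subrr.
  - by move=> u Ju; exact: step.
  - by move=> u Ju; exact: step.
have Jxx w : comm_ideal (commutator w w).
  by exists 0; rewrite commutatorxx mulr0.
have JAB : comm_ideal C by exists 1; rewrite mulr1.
by apply: (J_ind); apply/JC/(J_ind) => //; exact: JC.
Qed.

(** * A Lie subalgebra containing A and B contains C R *)

Section LieSubalgebra.
Hypothesis q_not_unity : forall n, (0 < n)%N -> q ^+ n != 1.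
Variable L : set (comm_lie R).
Hypothesis hL : is_lie_subalgebra L.
Hypotheses (LA : L A) (LB : L B).

Let q1 : q - 1 != 0.
Proof. by rewrite subr_eq0 -[q]expr1 q_not_unity. Qed.

Let qX1 k : q ^+ k.+1 - 1 != 0.
Proof. by rewrite subr_eq0 q_not_unity. Qed.

Let Lcomm (x y : R) : L x -> L y -> L (commutator x y).
Proof. exact: hL.2. Qed.

Let A_commX k x : A * (C ^+ k * x) = q ^+ k *: (C ^+ k * (A * x)).
Proof. by rewrite mulrA mul_A_commX -scalerAl mulrA. Qed.

Let B_commX k x : q ^+ k *: (B * (C ^+ k * x)) = C ^+ k * (B * x).
Proof. by rewrite mulrA scalerAl -mul_commX_B mulrA. Qed.

(** With K = k + 1, [A, C^K A^l] = (q^K - 1) C^K A^(l+1), and the factor is invertible. *)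
Lemma Lie_commX_A k l : L (C ^+ k.+1) -> L (C ^+ k.+1 * A ^+ l).
Proof.
move=> LC; elim: l => [|l IHl]; first by rewrite expr0 mulr1.
apply: (subspaceZK hL.1 (qX1 k)); move: (Lcomm LA IHl).
by rewrite /commutator A_commX -mulrA -exprS -exprSr scalerBl scale1r.
Qed.

(** With K = k + 1, q^K [C^K B^l, B] = (q^K - 1) C^K B^(l+1); the scaling by q^K avoids an
    inverse. *)
Lemma Lie_commX_B k l : L (C ^+ k.+1) -> L (C ^+ k.+1 * B ^+ l).
Proof.
move=> LC; elim: l => [|l IHl]; first by rewrite expr0 mulr1.
apply: (subspaceZK hL.1 (qX1 k)).
move: (subspaceZ hL.1 (q ^+ k.+1) (Lcomm IHl LB)).
rewrite /commutator scalerBr B_commX -mulrA -exprS -exprSr scalerBl.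
by rewrite scale1r.
Qed.

(** The scaling by q^k moves [B] past C^k, and the scaling by [q - 1] makes [B * A] and [A * B]
    affine in [C]. The result links two consecutive powers of [C]. *)
Let commutator_B_commXA k :
  (q - 1) *: (q ^+ k *: commutator B (C ^+ k * A))
  = (q ^+ k - 1) *: C ^+ k - (q ^+ k.+1 - 1) *: C ^+ k.+1.
Proof.
have -> : (q - 1) *: (q ^+ k *: commutator B (C ^+ k * A))
    = C ^+ k * ((q - 1) *: (B * A))
      - q ^+ k *: (C ^+ k * ((q - 1) *: (A * B))).
  rewrite /commutator [q ^+ k *: _]scalerBr B_commX scalerBr -!scalerAr.
  by rewrite -mulrA [q ^+ k *: (_ *: _)]scalerA mulrC -scalerA.
rewrite scale_BA scale_AB; move: C => D.
rewrite !(mulrBr, scalerBr, scalerBl) !mulr1 !scale1r.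
rewrite -scalerAr scalerA -!exprSr !opprB addrACA [RHS]addrACA.
by rewrite (addrC (D ^+ _)).
Qed.

(** Each power yields the next: bracketing [B] with C^(k+1) A gives a combination of C^(k+1) and
    C^(k+2), and the latter has a coefficient that does not vanish. *)
Lemma Lie_commX k : L (C ^+ k.+1).
Proof.
elim: k => [|k IHk]; first by rewrite expr1; exact: Lcomm.
have := Lie_commX_A 1 IHk; rewrite expr1 => /(Lcomm LB).
move/(subspaceZ hL.1 (q ^+ k.+1))/(subspaceZ hL.1 (q - 1)).
rewrite commutator_B_commXA => Ly; apply: (subspaceZK hL.1 (qX1 k.+1)).
move/(subspaceB hL.1 (subspaceZ hL.1 (q ^+ k.+1 - 1) IHk)): Ly.
by rewrite opprB addrC subrK.
Qed.

(* S lies in L, contains C, and is stable under right multiplication by A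
   and B, hence it contains CH. *)
Let S := Defs.span [set y : R | exists k l,
  y = C ^+ k.+1 * A ^+ l \/ y = C ^+ k.+1 * B ^+ l]%classic.

Let S_subspace : is_subspace S.
Proof.
split=> [U [[]]//|a x y Sx Sy U US]; apply: US.1.2; [exact: Sx|exact: Sy].
Qed.

Let S_sub_L x : S x -> L x.
Proof.
apply; split=> [|_ [k [l [->|->]]]]; first exact: hL.1.
  exact/Lie_commX_A/Lie_commX.
exact/Lie_commX_B/Lie_commX.
Qed.

Let S_A k l : S (C ^+ k.+1 * A ^+ l).
Proof. by move=> U [_]; apply; exists k, l; left. Qed.

Let S_B k l : S (C ^+ k.+1 * B ^+ l).
Proof. by move=> U [_]; apply; exists k, l; right. Qed.

Let S_mul_subspace (z : R) : is_subspace [set y | S (y * z)]%classic.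
Proof.
split=> [|a x y Sx Sy] /=; first by rewrite mul0r; case: S_subspace.
by rewrite mulrDl -scalerAl; apply: S_subspace.2.
Qed.

Let S_mulA x : S x -> S (x * A).
Proof.
move=> Sx; apply: (Sx [set y | S (y * A)]%classic).
split=> [|_ [k [[|l] [->|->]]]] /=; first exact: S_mul_subspace.
- by rewrite -mulrA mul1r; exact: (S_A k 1).
- by rewrite -mulrA mul1r; exact: (S_A k 1).
- by rewrite -mulrA -exprSr; exact: S_A.
(* In C^(k+1) B^l (B A), replace (q - 1) B A by C - 1; since q^l B^l C = C B^l, both terms are
   multiples of spanning elements. *)
rewrite [B ^+ _]exprSr -!mulrA; apply: (subspaceZK S_subspace q1).
rewrite 2!scalerAr scale_BA (mulrBr (B ^+ l)) mulr1 (mulrBr (C ^+ _)).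
apply: (subspaceB S_subspace) => //; apply: (subspaceZK S_subspace (qX0 l)).
by rewrite scalerAr -mul_comm_BX mulrA -exprSr.
Qed.

Let S_mulB x : S x -> S (x * B).
Proof.
move=> Sx; apply: (Sx [set y | S (y * B)]%classic).
split=> [|_ [k [[|l] [->|->]]]] /=; first exact: S_mul_subspace.
- by rewrite -mulrA mul1r; exact: (S_B k 1).
- by rewrite -mulrA mul1r; exact: (S_B k 1).
(* Likewise with (q - 1) A B = q C - 1 and A^l C = q^l C A^l. *)
- rewrite [A ^+ _]exprSr -!mulrA; apply: (subspaceZK S_subspace q1).
  rewrite 2!scalerAr scale_AB (mulrBr (A ^+ l)) mulr1 (mulrBr (C ^+ _)).
  rewrite -scalerAr mul_AX_comm -scalerAr.
  apply: (subspaceB S_subspace) => //; apply: (subspaceZ S_subspace).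
  rewrite -scalerAr mulrA -exprSr; exact: (subspaceZ S_subspace).
by rewrite -mulrA -exprSr; exact: S_B.
Qed.

Lemma Lie_comm_mul x : L (C * x).
Proof.
apply: S_sub_L; elim/R_ind: x => [||x|x].
- split=> [|a x y Sx Sy] /=; first by rewrite mulr0; case: S_subspace.
  by rewrite (mulrDr C) -scalerAr; apply: S_subspace.2.
- by rewrite -[C]expr1; exact: (S_A 0 0).
- by rewrite mulrA; exact: S_mulA.
- by rewrite mulrA; exact: S_mulB.
Qed.

End LieSubalgebra.
End QRelation.

(** * Induction and scalar evaluation in the free algebra *)

Lemma malgMUU (F : fieldType) (K : monomType) (c d : F) (k l : K) :
  << c *g k >> * << d *g l >> = << c * d *g mmul k l >> :> {malg F[K]}.
Proof. exact: fgmulUU. Qed.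

Lemma free_alg_ind (F : fieldType) (X : choiceType) (P : free_alg F X -> Prop) :
  is_subspace P -> P 1 -> (forall g i, P g -> P (g * free_gen F i)) ->
  forall g, P g.
Proof.
move=> hP P1 PM g; rewrite [g](@monalgE {fmonom X} F).
apply: (subspace_sum hP) => k.
have -> : << g@_k *g k >> = g@_k *: << k >> :> {malg F[{fmonom X}]}.
  by rewrite -mul_malgC malgMUU mulr1 mul1m.
apply: (subspaceZ hP); case: k => s; elim/last_ind: s => [|s i IHs].
  by rewrite -fmoneE.
have -> : << FMonom (rcons s i) >> = << FMonom s >> * << fmu i >>
    :> {malg F[{fmonom X}]}.
  rewrite malgMUU mulr1; congr << _ *g _ >>; apply/eqP.
  by rewrite fmP fmM fmU cats1.
exact: PM.
Qed.

Section FreeEvaluation.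
Variables (F : fieldType) (X : choiceType) (u : X -> F).

Definition word_eval (k : {fmonom X}) : F := \prod_(i <- (k : seq X)) u i.

Lemma word_eval_mmorphism : mmorphism word_eval.
Proof.
by split=> [k l|]; rewrite /word_eval ?fmM ?fm1 ?big_cat ?big_nil.
Qed.

HB.instance Definition _ :=
  monalg.isMultiplicative.Build {fmonom X} F word_eval word_eval_mmorphism.

Definition free_eval (g : free_alg F X) : F :=
  mmap idfun word_eval (g : {malg F[{fmonom X}]}).

HB.instance Definition _ := GRing.LRMorphism.copy free_eval
  (mmap idfun word_eval : {malg F[{fmonom X}]} -> F).

Lemma free_eval_gen i : free_eval (free_gen F i) = u i.
Proof. by rewrite /free_eval mmapU /= mul1r /word_eval fmU big_seq1. Qed.

End FreeEvaluation.

(** Transfers word induction to the quotient; it supplies the generation hypothesis [R_ind]. *)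
Lemma qheis_ind (F : fieldType) (q : F) (P : qheis q -> Prop) :
  is_subspace P -> P 1 -> (forall x, P x -> P (x * qheisA q)) ->
  (forall x, P x -> P (x * qheisB q)) -> forall x, P x.
Proof.
move=> hP P1 PA PB x; rewrite -[x]alg_reprK.
elim/free_alg_ind: (alg_repr x) => [||g i Pg].
- split=> [|a g h Pg Ph] /=; first by rewrite linear0; exact: hP.1.
  by rewrite linearP; exact: hP.2.
- by rewrite rmorph1.
rewrite rmorphM /=; case: i => [[|[|]]] //= lti.
  by rewrite (_ : Ordinal lti = 0); [exact: PA | exact: val_inj].
by rewrite (_ : Ordinal lti = 1); [exact: PB | exact: val_inj].
Qed.

(** * Characters of H(q) *)

Section QHeisenbergEvaluation.
Variables (F : fieldType) (q a b : F).
Hypothesis ab_rel : a * b - q * (b * a) = 1.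

(* The proof argument only serves to key the morphism instances below. *)
Definition qheis_eval of a * b - q * (b * a) = 1 : qheis q -> F :=
  fun x => free_eval (fun i : 'I_2 => if i == 0 then a else b) (alg_repr x).

Local Notation ev := (qheis_eval ab_rel).

(** The value does not depend on the representative: the kernel of the evaluation is a two-sided
    ideal containing the relator, hence contains [qheis_ideal q]. *)
Let evE g :
  ev (qheis_proj q g) = free_eval (fun i => if i == 0 then a else b) g.
Proof.
set u := fun i : 'I_2 => _.
pose K : set (free_alg F 'I_2) := [set h | free_eval u h = 0]%classic.
have J_mem : qheis_ideal q (alg_repr (qheis_proj q g) - g).
  apply/(alg_projP (ideal_generated_is_ideal _) (@qheis_ideal_proper F q)).
  exact: (@alg_reprK _ _ _ _ (@qheis_ideal_proper F q)).
apply/eqP; rewrite -subr_eq0 -raddfB; apply/eqP/(J_mem K).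
split; last first.
  move=> _ ->; rewrite /K /qheis_relator /= !raddfB /= linearZ /= rmorph1.
  by rewrite !rmorphM /= !free_eval_gen ab_rel subrr.
split=> [|g1 h hK]; last by rewrite /K /= !rmorphM /= hK mulr0 mul0r.
split=> [|c g1 g2 K1 K2]; rewrite /K /=; first by rewrite raddf0.
by rewrite raddfD /= linearZ /= K1 K2 mulr0 addr0.
Qed.

Lemma qheis_eval_linear : linear_for *%R ev.
Proof.
move=> c x y; rewrite -[x]alg_reprK -[y]alg_reprK -linearP !evE.
by rewrite raddfD /= linearZ.
Qed.

HB.instance Definition _ :=
  GRing.isLinear.Build F (qheis q) F *%R ev qheis_eval_linear.

Lemma qheis_eval_monoid_morphism : monoid_morphism ev.
Proof.
split=> [|x y]; first by rewrite -(rmorph1 (qheis_proj q)) evE rmorph1.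
by rewrite -[x]alg_reprK -[y]alg_reprK -rmorphM !evE rmorphM.
Qed.

HB.instance Definition _ :=
  GRing.isMonoidMorphism.Build (qheis q) F ev qheis_eval_monoid_morphism.

Lemma qheis_evalA : ev (qheisA q) = a.
Proof. by rewrite evE free_eval_gen. Qed.

Lemma qheis_evalB : ev (qheisB q) = b.
Proof. by rewrite evE free_eval_gen. Qed.

End QHeisenbergEvaluation.

(** * General facts on Lie algebras and on roots of polynomials *)

Lemma lie_generated_subalgebra (F : fieldType) (L : lieAlgType F) (S : set L) :
  is_lie_subalgebra (lie_generated S).
Proof.
split=> [|x y Lx Ly U US]; last by apply: US.1.2; [exact: Lx | exact: Ly].
split=> [U US|a x y Lx Ly U US]; first by have [[[]]] := US.
by apply: US.1.1.2; [exact: Lx | exact: Ly].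
Qed.

Lemma infinite_dimensional_neq0 (F : fieldType) (V : lmodType F) :
  infinite_dimensional V -> setT <> [set (0 : V)]%classic.
Proof.
move=> infV VE; apply: infV; exists [::]; rewrite VE; apply/seteqP.
split=> [x|_ -> U [[U0 _] _] //]; apply.
by split=> //; split=> // a y z -> ->; rewrite scaler0 addr0.
Qed.

(** Minimality of 1 only has to exclude p = 0, where the term of the series is the whole algebra. *)
Lemma step_nilpotent1 (F : fieldType) (L : lieAlgType F) :
  setT <> [set (0 : L)]%classic -> (forall x y : L, lie x y = 0) ->
  step_nilpotent L 1.
Proof.
move=> L0 abL; split=> [|[|//] _]; last exact: L0.
apply/seteqP; split=> [x|_ -> U [[U0 _] _] //]; apply.
split=> [|_ [y [z [_ ->]]]]; last exact: abL.
by split=> // a y z -> ->; rewrite scaler0 addr0.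
Qed.

(** The powers of [q] are pairwise distinct, since q^m = q^n with m < n would give q^(n-m) = 1. A
    nonzero [p] has fewer than [size p] roots. *)
Lemma poly_eq0_of_powers (F : fieldType) (q : F) (p : {poly F}) : q != 0 ->
  (forall n, (0 < n)%N -> q ^+ n != 1) -> (forall n, p.[q ^+ n] = 0) -> p = 0.
Proof.
move=> q0 q1 pq; apply: contraTeq isT => p0.
pose rs := [seq q ^+ n | n <- iota 0 (size p)].
suff : (size rs < size p)%N by rewrite size_map size_iota ltnn.
apply: max_poly_roots => //.
  by apply/allP => _ /mapP [n _ ->]; apply/rootP.
rewrite map_inj_uniq ?iota_uniq //.
suff inj m n : (m <= n)%N -> q ^+ m = q ^+ n -> m = n.
  move=> m n mn; case: (leqP m n) => [le_mn|/ltnW le_nm]; first exact: inj.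
  exact/esym/inj.
move=> le_mn; rewrite -{1}(subnK le_mn) exprD -{1}[q ^+ m]mul1r.
move/(mulIf (expf_neq0 _ q0))/esym/eqP.
case: (posnP (n - m)) => [/eqP|/q1/negPf -> //].
by rewrite subn_eq0 => le_nm _; apply/eqP; rewrite eqn_leq le_mn.
Qed.

(** * The Lie ideal generated by A and B, and its quotient *)

Section QHeisenbergLie.
Variables (F : fieldType) (q : F).
Hypothesis q0 : q != 0.
Hypothesis q_not_unity : forall n, (0 < n)%N -> q ^+ n != 1.

Local Notation H := (qheis q).
Local Notation A := (qheisA q).
Local Notation B := (qheisB q).

(** The inclusions of [H, H] in C H and of C H in L give both the ideal property and the vanishing
    of all brackets in the quotient. *)
Lemma qheis_commutator_in_gen (x y : H) : qheis_lie_gen q (commutator x y).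
Proof.
have [z ->] := commutator_in_ideal (qheis_relation q) q0 (@qheis_ind F q) x y.
apply: (Lie_comm_mul (qheis_relation q) q0 (@qheis_ind F q) q_not_unity).
- exact: lie_generated_subalgebra.
- by move=> U [_]; apply; left.
- by move=> U [_]; apply; right.
Qed.

Lemma qheis_lie_gen_ideal : is_lie_ideal (qheis_lie_gen q).
Proof.
split=> [|x u _]; first exact: (lie_generated_subalgebra _).1.
exact: qheis_commutator_in_gen.
Qed.

(** In the commutative ring [F] the defining relation reads (1 - q) a b = 1, which determines b from
    a = t. *)
Lemma qheis_character_rel t : t != 0 ->
  t * ((1 - q)^-1 * t^-1) - q * ((1 - q)^-1 * t^-1 * t) = 1.
Proof.
move=> t0; rewrite mulrCA mulrAC -mulrA mulfV // !mulr1 -{1}[_^-1]mul1r -mulrBl.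
by rewrite mulfV // subr_eq0 eq_sym -[q]expr1 q_not_unity.
Qed.

(* The values of an element of L at the one-dimensional representation
   A |-> t, B |-> t^-1 / (1 - q) are those of a Laurent polynomial
   c t + d / t. *)
Lemma qheis_lie_gen_eval (x : H) : qheis_lie_gen q x ->
  exists c d : F, forall t (t0 : t != 0),
    qheis_eval (qheis_character_rel t0) x = c * t + d * t^-1.
Proof.
move=> /(_ [set x : H | exists c d : F, forall t (t0 : t != 0),
  qheis_eval (qheis_character_rel t0) x = c * t + d * t^-1]%classic); apply.
split=> [|_ [->|->]] /=; last 2 first.
- by exists 1, 0 => t t0; rewrite qheis_evalA mul1r mul0r addr0.
- by exists 0, (1 - q)^-1 => t t0; rewrite qheis_evalB mul0r add0r.
(* A commutator takes the value 0 at every character, [F] being commutative. *)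
split=> [|y z _ _] /=; last first.
  exists 0, 0 => t t0.
  by rewrite !mul0r addr0 raddfB /= !rmorphM /= mulrC subrr.
split=> [|r y z [c [d yE]] [c' [d' zE]]] /=.
  by exists 0, 0 => t t0; rewrite !mul0r addr0 raddf0.
exists (r * c + c'), (r * d + d') => t t0.
by rewrite linearP /= yE zE mulrDr !mulrA !mulrDl addrACA.
Qed.

Lemma qheis_lie_quot_infinite (hL : is_lie_ideal (qheis_lie_gen q)) :
  infinite_dimensional (lie_quot hL).
Proof.
pose v (m : nat) : lie_quot hL := lie_proj hL (A ^+ m.+2 : H).
move=> /(finite_dimensional_dependent v) [n [c [c0 cv]]].
have /qheis_lie_gen_eval [a [b LE]] :
    qheis_lie_gen q (\sum_i c 0 i *: A ^+ i.+2 : H).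
  rewrite -[X in _ X]subr0; apply/(lie_projP hL).
  rewrite !linear_sum linear0 -[RHS]cv; apply: eq_bigr => i _.
  by rewrite linearZ.
(* This is the identity between values multiplied by t to clear 1/t. As the powers of [A] start at
   2, the terms of the sum have degree at least 3 and meet neither of the other two. *)
pose p : {poly F} := \sum_i c 0 i *: 'X^(i.+3) - a *: 'X^2 - b%:P.
suff p0 : p = 0.
  case/eqP: c0; apply/rowP => i; rewrite mxE.
  have := congr1 (fun r : {poly F} => r`_i.+3) p0.
  rewrite !coefB coef_sum coefZ coefXn coefC coef0 (bigD1 i) //=.
  rewrite big1 => [|j /negPf ji].
    by rewrite coefZ coefXn eqxx mulr1 mulr0 !subr0 addr0.
  by rewrite coefZ coefXn !eqSS eq_sym (inj_eq val_inj) ji mulr0.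
apply: (poly_eq0_of_powers q0 q_not_unity) => k.
have t0 : q ^+ k != 0 by rewrite expf_neq0.
have /(congr1 ( *%R (q ^+ k))) := LE _ t0.
rewrite mulrDr mulrCA -expr2 [_ * (b / _)]mulrC divfK // => E.
rewrite /p !hornerD !hornerN hornerZ hornerXn hornerC -addrA -opprD.
apply/eqP; rewrite subr_eq0 -E linear_sum horner_sum mulr_sumr; apply/eqP.
apply: eq_bigr => i _; rewrite hornerZ hornerXn exprS; move: i.+2 => m.
by rewrite linearZ /= rmorphXn /= qheis_evalA mulrCA.
Qed.

End QHeisenbergLie.

Theorem theorem5p10 (F : fieldType) (q : F)
    (q_neq0 : q != 0)
    (q_not_root_of_unity : forall n : nat, (0 < n)%N -> q ^+ n != 1) :
  exists hL : is_lie_ideal (qheis_lie_gen q),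
    infinite_dimensional (lie_quot hL) /\ step_nilpotent (lie_quot hL) 1.
Proof.
have hL := qheis_lie_gen_ideal q_neq0 q_not_root_of_unity; exists hL.
have infL := qheis_lie_quot_infinite q_neq0 q_not_root_of_unity (hL := hL).
split=> //; apply: step_nilpotent1; first exact: infinite_dimensional_neq0.
move=> x y; rewrite -[x]lie_reprK -[y]lie_reprK.
transitivity (lie_proj hL (lie (lie_repr x) (lie_repr y))).
  by rewrite lie_proj_bracket.
rewrite -(linear0 (lie_proj hL)); apply/lie_projP; rewrite subr0.
exact: qheis_commutator_in_gen.
Qed.
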